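(* Assume that the operators $F_0,\dots,F_{N-1}$ are Fréchet differentiable in $B_\rho(x_0)$ and satisfy there the scaling condition $$\|F_i'(x)\|\le 1,\qquad x\in B_\rho(x_0),\ i=0,\dots,N-1,$$ and the local tangential cone condition $$\|F_i(x)-F_i(\bar x)-F_i'(x)(x-\bar x)\|\le \eta\,\|F_i(x)-F_i(\bar x)\|,\qquad x,\bar x\in B_\rho(x_0),\ i=0,\dots,N-1,$$ for some $\eta<1/2$, and that the system $F_i(x)=y^i$, $i=0,\dots,N-1$, has a solution in $B_{\rho/2}(x_0)$. Let $\tau>2\frac{1+\eta}{1-2\eta}$. Then: 1. For exact data $y^{\delta,i}=y^i$, the sequence $(x_n)$ of the loping Landweber--Kaczmarz iteration converges to a solution of $F_i(x)=y^i$, $i=0,\dots,N-1$. Moreover, if $x^\dagger$ denotes the unique solution of this system with minimal distance to $x_0$ and $$\mathcal N(F_i'(x^\dagger))\subseteq \mathcal N(F_i'(x)),\qquad x\in B_\rho(x_0),\ i\in\{0,\dots,N-1\}, \qquad ( * )$$ then $x_n\to x^\dagger$. 2. For noisy data, the loping Landweber--Kaczmarz iterates $x_{n_*^\delta}$ converge to a solution of $F_i(x)=y^i$, $i=0,\dots,N-1$, as $\delta\to0$. If in addition $( * )$ holds, then $x_{n_*^\delta}$ converges to $x^\dagger$ as $\delta\to0$.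
   Context: $X,Y$ are separable Hilbert spaces, $N\ge1$, $F_i:D_i\subseteq X\to Y$ for $i=0,\dots,N-1$, $y^i\in Y$ are the exact data. $x_0\in X$ is a fixed starting value, $\rho>0$, $B_r(x_0)$ is the closed ball of radius $r$ around $x_0$, and $B_\rho(x_0)\subset\bigcap_{i}D_i$. $F_i'(x)$ is the Fréchet derivative, $F_i'(x)^*$ its Hilbert space adjoint, $\mathcal N(\cdot)$ denotes the null space. Data: noisy data $y^{\delta,i}\in Y$ satisfy $\|y^{\delta,i}-y^i\|<\delta^i$ with noise levels $\delta^i>0$, $i=0,\dots,N-1$; exact data means $y^{\delta,i}=y^i$ with $\delta^i=0$. Loping Landweber--Kaczmarz iteration: with $[n]:=n \bmod N\in\{0,\dots,N-1\}$, starting from $x_0$, $$x_{n+1}=x_n-\omega_n F_{[n]}'(x_n)^*\big(F_{[n]}(x_n)-y^{\delta,[n]}\big),$$ where $\omega_n=1$ if $\|F_{[n]}(x_n)-y^{\delta,[n]}\|>\tau\delta^{[n]}$ and $\omega_n=0$ otherwise. (For exact data these iterates coincide with those obtained with $\omega_n=1$ for all $n$.) Termination index (noisy data): $n_*^\delta=n_*^\delta(y^\delta)$ is the smallest integer multiple of $N$ such that $x_{n_*^\delta}=x_{n_*^\delta+1}=\dots=x_{n_*^\delta+N}$. ''As $\delta\to0$'' means: the exact data $y^i$ and $x_0$ are fixed, and along any sequence of noise levels with $\max_i\delta^i\to0$ and any corresponding noisy data, the iterates $x_{n_*^\delta}$ (computed from the noisy data) converge to the stated limit.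
   Formalization: In part 2, both convergence claims for noisy data as δ→0 additionally assume that x ↦ F_i'(x) is continuous in operator norm on B_ρ(x_0) for every i; with merely Fréchet differentiable operators they can fail. *)

(* Defs.v *)
From HB Require Import structures.
From mathcomp Require Import all_boot all_order all_algebra.
From mathcomp Require Import sesquilinear.
From mathcomp Require Import all_classical all_reals all_analysis.

Set Implicit Arguments.
Unset Strict Implicit.
Unset Printing Implicit Defensive.

Import Order.TTheory GRing.Theory Num.Theory.
Import numFieldNormedType.Exports.

Local Open Scope classical_set_scope.
Local Open Scope ring_scope.

(* Real Hilbert spaces.  A complex Hilbert space is also one, with inner product
   Re <x, y>; norms, Frechet derivatives, null spaces and adjoints of
   complex-linear maps are the same for both structures. *)
HB.mixin Record isHilbert (R : realType) H of CompleteNormedModule R H := {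
  inner : {dot H for (@idfun R)} ;
  inner_normE : forall x : H, inner x x = `|x| ^+ 2 }.

#[short(type="hilbertType")]
HB.structure Definition Hilbert (R : realType) :=
  { H of isHilbert R H & CompleteNormedModule R H }.

Definition separable_space (T : topologicalType) : Prop :=
  exists A : set T, countable A /\ dense A.

(* The adjoint exists and is unique for bounded linear A (Riesz); for other A
   the value is irrelevant. *)
Definition adjoint (R : realType) (X Y : hilbertType R) (A : X -> Y) : Y -> X :=
  get [set B : Y -> X | forall (h : X) (k : Y), inner (A h) k = inner h (B k)].

(* Meaningful for bounded A only: [sup] of an unbounded set is 0. *)
Definition opnorm (R : realType) (X Y : normedModType R) (A : X -> Y) : R :=
  sup [set `|A h| | h in [set h : X | `|h| <= 1]].

Definition ker (R : realType) (X Y : normedModType R) (A : X -> Y) : set X :=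
  A @^-1` [set 0].

(* Frechet differentiability of f : D -> Y, where f is given by a total function
   whose values outside D are junk: increments are restricted to D.  If D is a
   neighbourhood of x this is [differentiable f x], and the derivative is ['d f x];
   it also makes sense at a boundary point of a ball contained in D. *)
Definition differentiable_in (R : realType) (X Y : normedModType R)
    (D : set X) (f : X -> Y) (x : X) : Prop :=
  differentiable f (within D (nbhs x)).

Definition deriv_in (R : realType) (X Y : normedModType R)
    (D : set X) (f : X -> Y) (x : X) : X -> Y :=
  'd f (within D (nbhs x)).

(* Continuity on B of z |-> deriv_in D f z for the operator norm. *)
Definition continuous_deriv_on (R : realType) (X Y : normedModType R)
    (D B : set X) (f : X -> Y) : Prop :=
  forall x, B x ->
    opnorm (fun h => deriv_in D f z h - deriv_in D f x h)
      @[z --> within B (nbhs x)] --> (0 : R).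

Definition tangential_cone (R : realType) (X Y : normedModType R)
    (D B : set X) (f : X -> Y) (eta : R) : Prop :=
  forall x xb, B x -> B xb ->
    `|f x - f xb - deriv_in D f x (x - xb)| <= eta * `|f x - f xb|.

Definition is_solution (R : realType) (X Y : normedModType R) (N : nat)
    (D : 'I_N -> set X) (F : 'I_N -> X -> Y) (y : 'I_N -> Y) (x : X) : Prop :=
  forall i, D i x /\ F i x = y i.

Definition is_min_dist_solution (R : realType) (X Y : normedModType R) (N : nat)
    (D : 'I_N -> set X) (F : 'I_N -> X -> Y) (y : 'I_N -> Y) (x0 x : X) : Prop :=
  is_solution D F y x /\
  forall z, is_solution D F y z -> `|x - x0| <= `|z - x0|.

Definition cyc (N : nat) (hN : (0 < N)%N) (n : nat) : 'I_N :=
  Ordinal (ltn_pmod n hN).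

Definition loping (R : realType) (Y : normedModType R) (r : Y) (c : R) : R :=
  if c < `|r| then 1 else 0.

Fixpoint lLK (R : realType) (X Y : hilbertType R) (N : nat) (hN : (0 < N)%N)
    (D : 'I_N -> set X) (F : 'I_N -> X -> Y) (yd : 'I_N -> Y)
    (delta : 'I_N -> R) (tau : R) (x0 : X) (n : nat) : X :=
  if n is m.+1 then
    let x := lLK hN D F yd delta tau x0 m in
    let i := cyc hN m in
    let r := F i x - yd i in
    x - loping r (tau * delta i) *: adjoint (deriv_in (D i) (F i) x) r
  else x0.

Definition stationary_cycle (T : Type) (N : nat) (u : nat -> T) (n : nat) : Prop :=
  (N %| n)%N /\ forall j, (j <= N)%N -> u (n + j)%N = u n.

Definition is_termination_index (T : Type) (N : nat) (u : nat -> T) (n : nat) : Prop :=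
  stationary_cycle N u n /\ forall m, stationary_cycle N u m -> (n <= m)%N.

Definition is_noisy_data (R : realType) (Y : normedModType R) (N : nat)
    (y yd : 'I_N -> Y) (delta : 'I_N -> R) : Prop :=
  forall i, 0 < delta i /\ `|yd i - y i| < delta i.

(* "x_{n_*^delta} converges to xlim as delta -> 0", along arbitrary sequences of
   noise levels and noisy data; nstar k is the termination index of the k-th run. *)
Definition noisy_limit (R : realType) (X Y : hilbertType R) (N : nat)
    (hN : (0 < N)%N) (D : 'I_N -> set X) (F : 'I_N -> X -> Y) (y : 'I_N -> Y)
    (tau : R) (x0 xlim : X) : Prop :=
  forall (delta : nat -> 'I_N -> R) (yd : nat -> 'I_N -> Y) (nstar : nat -> nat),
    (forall k, is_noisy_data y (yd k) (delta k)) ->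
    \big[Num.max/0]_(i < N) delta k i @[k --> \oo] --> (0 : R) ->
    (forall k,
       is_termination_index N (lLK hN D F (yd k) (delta k) tau x0) (nstar k)) ->
    lLK hN D F (yd k) (delta k) tau x0 (nstar k) @[k --> \oo] --> xlim.

Definition kernel_condition (R : realType) (X Y : normedModType R) (N : nat)
    (D : 'I_N -> set X) (B : set X) (F : 'I_N -> X -> Y) (xd : X) : Prop :=
  forall x i, B x ->
    ker (deriv_in (D i) (F i) xd) `<=` ker (deriv_in (D i) (F i) x).

(* Main.v *)
Require Import Defs.
From HB Require Import structures.
From mathcomp Require Import all_boot all_order all_algebra.
From mathcomp Require Import sesquilinear.
From mathcomp Require Import all_classical all_reals all_analysis.
From mathcomp Require Import ring lra.
Import Order.TTheory GRing.Theory Num.Theory.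
Import numFieldNormedType.Exports.
Local Open Scope classical_set_scope.
Local Open Scope ring_scope.

(** The argument rests on one estimate ([step_descent]). At a point [x] of the
    ball with residual [r = F_i x - yd_i], the cone condition says that
    [F_i'(x) (x - xs)] equals [r] up to [eta * |F_i x - y_i|] and the data error,
    for every solution [xs] in the ball. Hence a step along [- F_i'(x)^* r]
    decreases the squared distance to [xs] by at least [descent_rate * |r|^2]
    whenever [|r| > tau * delta_i]; the bound on [tau] is what makes this rate
    positive. Skipped steps change nothing, so the iterates approach every
    solution in the ball monotonically, never leave the ball, and their active
    squared residuals are summable.

    Termination. With positive noise levels each active step costs at least a
    fixed amount of squared distance, so some cycle is inactive
    ([lLK_terminates]).

    Exact data. Monotonicity alone does not give strong convergence. To get
    it, let [z_c] be the start of cycle [c] and [R_c] the sum of the residual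
    norms of that cycle. The update of each step lies in the range of an
    adjoint, so its inner product with an error [z_n - xs] can be moved to the
    other side of that adjoint, where the cone condition bounds it by residuals
    of the cycles [c] and [n]. When [R_n] is smallest, the total is at most
    [8 * R_c ^ 2] per cycle ([inner_cycle_le]), and this sum is controlled by the
    loss of squared distance. Comparing [z_m] and [z_p] through the intermediate
    [z_n] with smallest residual gives
    [|z_m - z_p|^2 <= K * (|z_m - xs|^2 - |z_p - xs|^2)]
    ([cycle_start_sq_dist_le]), and the right-hand side is a difference of a
    convergent sequence.

    Under the kernel condition all updates are orthogonal to the common kernel of
    the derivatives, which contains the difference between the limit and the
    solution nearest to [x0]; Pythagoras identifies the two
    ([exact_limit_min_dist]). That nearest solution exists and is unique because
    the solutions in the ball form a closed convex set.

    Vanishing noise. For fixed [n] the noisy iterate of index [n] converges to the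
    exact one ([noisy_iterate_cvg]). For every [n], before or after termination,
    the terminal iterate is no farther from the exact limit than the noisy iterate
    of index [n]: this is monotonicity in one case and stationarity in the other.
    The two facts together give the limit without any control on the termination
    index ([noisy_terminal_cvg]).

    The descent estimate assumes [0 <= eta]. A negative [eta] forces every
    [F_i] to be constant on the ball, and the iteration never leaves [x0]. *)

Set Implicit Arguments.
Unset Strict Implicit.
Unset Printing Implicit Defensive.

(** * Auxiliary facts on real numbers and convergence *)

Section Auxiliary.
Context {R : realType}.

Lemma quadratic_ge0_linear_eq0 (b c : R) :
  0 <= c -> (forall t, 0 <= 2 * t * b + t ^+ 2 * c) -> b = 0.
Proof.
(* near the minimizer [- b / c], with [c + 1] in place of a possibly zero [c] *)
move=> c0 /(_ (- b / (c + 1))) h; apply/eqP; rewrite -sqrf_eq0 -[_ == 0]negbK.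
apply/negP => b0; have {}b0 : 0 < b ^+ 2 by rewrite lt0r b0 sqr_ge0.
have c1 : 0 < c + 1 by lra.
move: h; apply/negP; rewrite -ltNge.
have -> : 2 * (- b / (c + 1)) * b + (- b / (c + 1)) ^+ 2 * c =
    - (b ^+ 2 * (c + 2)) / (c + 1) ^+ 2 by field; rewrite gt_eqF.
rewrite mulNr oppr_lt0; apply: divr_gt0; last exact: exprn_gt0.
by apply: mulr_gt0 => //; lra.
Qed.

Lemma sqr_sum_le n (a : 'I_n -> R) :
  (\sum_i a i) ^+ 2 <= n%:R * \sum_i a i ^+ 2.
Proof.
have -> : n%:R * \sum_i a i ^+ 2 = \sum_i \sum_j (a i ^+ 2 + a j ^+ 2) / 2.
  apply/esym; under eq_bigr do rewrite -mulr_suml big_split/= sumr_const card_ord.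
  rewrite -mulr_suml big_split/= sumr_const card_ord sumrMnl.
  by rewrite mulr_natl; set S := _ *+ n; field.
rewrite expr2 big_distrlr/=; apply: ler_sum => i _; apply: ler_sum => j _.
have := sqr_ge0 (a i - a j); rewrite sqrrB; lra.
Qed.

Lemma exists_min_in_range (f : nat -> R) m p : (m <= p)%N ->
  exists n, (m <= n <= p)%N /\ forall c, (m <= c <= p)%N -> f n <= f c.
Proof.
elim: p => [|p IH]; first by rewrite leqn0 => /eqP ->; exists 0%N; split => // -[].
rewrite leq_eqVlt => /predU1P[->|/IH[n [/andP[mn np] nmin]]].
  by exists p.+1; rewrite leqnn; split => // c; rewrite -eqn_leq => /eqP ->.
have [fp|fp] := leP (f n) (f p.+1).
  exists n; rewrite mn (leqW np); split => // c /andP[mc].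
  by rewrite leq_eqVlt => /predU1P[->//|cp]; apply: nmin; rewrite mc.
exists p.+1; rewrite leqnn (leqW (leq_trans mn np)); split => // c /andP[mc].
rewrite leq_eqVlt => /predU1P[->//|cp]; apply: le_trans (ltW fp) _.
by apply: nmin; rewrite mc.
Qed.

Lemma mem_ballE (V : normedModType R) (x0 : V) r x :
  0 < r -> closed_ball x0 r x <-> `|x - x0| <= r.
Proof. by move=> r0; rewrite closed_ballE//= /closed_ball_ /= distrC. Qed.

Lemma cvg0_of_sq_le (V : normedModType R) (u : nat -> V) (e : nat -> R) :
  e n @[n --> \oo] --> 0 -> (forall n, `|u n| ^+ 2 <= e n) ->
  u n @[n --> \oo] --> 0.
Proof.
move=> e0 ue; apply/cvgr0Pnorm_lt => _/posnumP[r].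
have : \forall n \near \oo, e n < r%:num ^+ 2.
  by apply: (cvgr_lt _ e0); rewrite exprn_gt0.
apply: filterS => n en; rewrite -ltr_sqr ?nnegrE//.
exact: le_lt_trans (ue n) en.
Qed.

Lemma cvg_of_dist_le (T : Type) (G : set_system T) (FG : Filter G)
    (V : normedModType R) (u : T -> V) (l : V) (e : T -> R) :
  e t @[t --> G] --> 0 -> (\forall t \near G, `|u t - l| <= e t) ->
  u t @[t --> G] --> l.
Proof.
move=> e0 ue; apply/cvgrPdistC_lt => r r0.
have : \forall t \near G, e t < r by apply: (cvgr_lt _ e0).
by apply: filterS2 ue => t ut et; exact: le_lt_trans ut et.
Qed.

Lemma dist_cvg0 (T : Type) (G : set_system T) (FG : Filter G)
    (V : normedModType R) (u : T -> V) (l : V) :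
  u t @[t --> G] --> l -> `|u t - l| @[t --> G] --> 0.
Proof.
move=> ul; rewrite -(normr0 V) -(subrr l); apply: cvg_norm.
by apply: cvgB => //; exact: cvg_cst.
Qed.

End Auxiliary.

(** * Geometry of Hilbert spaces *)

Section Inner.
Context {R : realType} {H : hilbertType R}.
Implicit Types u v w : H.

Lemma innerC u v : inner u v = inner v u.
Proof. by rewrite hermC expr0 mul1r. Qed.

Lemma innerDl u v w : inner (u + v) w = inner u w + inner v w.
Proof. exact: linearDl. Qed.
Lemma innerDr u v w : inner u (v + w) = inner u v + inner u w.
Proof. exact: linearDr. Qed.
Lemma innerNl u v : inner (- u) v = - inner u v.
Proof. exact: linearNl. Qed.
Lemma innerNr u v : inner u (- v) = - inner u v.
Proof. exact: linearNr. Qed.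
Lemma innerZl a u v : inner (a *: u) v = a * inner u v.
Proof. exact: linearZl_LR. Qed.
Lemma innerZr a u v : inner u (a *: v) = a * inner u v.
Proof. by rewrite innerC innerZl innerC. Qed.

Lemma normD_sq u v : `|u + v| ^+ 2 = `|u| ^+ 2 + 2 * inner u v + `|v| ^+ 2.
Proof.
by rewrite -!inner_normE innerDl !innerDr (innerC v u); ring.
Qed.

Lemma normB_sq u v : `|u - v| ^+ 2 = `|u| ^+ 2 - 2 * inner u v + `|v| ^+ 2.
Proof. by rewrite normD_sq normrN innerNr; ring. Qed.

Lemma parallelogram_law u v :
  `|u + v| ^+ 2 + `|u - v| ^+ 2 = 2 * (`|u| ^+ 2 + `|v| ^+ 2).
Proof. by rewrite normD_sq normB_sq; ring. Qed.

Lemma cauchy_schwarz u v : `|inner u v| <= `|u| * `|v|.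
Proof.
have [->|v0] := eqVneq v 0.
  by rewrite -(scale0r (0 : H)) innerZr mul0r !normr0 mulr_ge0.
have nv : 0 < `|v| ^+ 2 by rewrite exprn_gt0 ?normr_gt0.
set t := inner u v / `|v| ^+ 2.
have : 0 <= `|u - t *: v| ^+ 2 by rewrite sqr_ge0.
rewrite normB_sq innerZr normrZ exprMn real_normK ?num_real//.
have -> : `|u| ^+ 2 - 2 * (t * inner u v) + t ^+ 2 * `|v| ^+ 2 =
    (`|u| ^+ 2 * `|v| ^+ 2 - inner u v ^+ 2) / `|v| ^+ 2.
  by rewrite /t; field; rewrite normr_eq0.
rewrite pmulr_lge0 ?invr_gt0// subr_ge0 -exprMn => le2.
by rewrite -ler_sqr ?nnegrE ?mulr_ge0// real_normK ?num_real.
Qed.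

(** Distances enter squared because in a Hilbert space they come out of
    identities for squared norms; the modulus may depend on the smaller index
    only. *)
Lemma cvg_of_sq_dist_le (u : nat -> H) (e : nat -> R) :
  e n @[n --> \oo] --> 0 ->
  (forall m n, (m <= n)%N -> `|u m - u n| ^+ 2 <= e m) ->
  cvg (u n @[n --> \oo]).
Proof.
move=> e0 ue; apply/cauchy_cvgP/cauchyP => _/posnumP[r].
have [n _ /= en] : \forall n \near \oo, e n < r%:num ^+ 2.
  by apply: (cvgr_lt _ e0); rewrite exprn_gt0.
exists (u n), n => // m /= nm; rewrite -ball_normE /=.
rewrite -ltr_sqr ?nnegrE//; apply: le_lt_trans (en n _) => //=; exact: ue.
Qed.

Lemma midpointB u v p : 2^-1 *: (u + v) - p = 2^-1 *: ((u - p) + (v - p)).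
Proof.
rewrite addrACA -opprD [RHS]scalerBr -mulr2n -(scaler_nat 2 p) scalerA.
by rewrite mulVf ?scale1r// pnatr_eq0.
Qed.

(** A minimizing sequence is Cauchy by the parallelogram law: the midpoint of
    two almost nearest points is no closer than the infimum. *)
Lemma nearest_point_exists (C : set H) p :
  C !=set0 -> closed C ->
  (forall u v, C u -> C v -> C (2^-1 *: (u + v))) ->
  exists u, C u /\ forall v, C v -> `|u - p| <= `|v - p|.
Proof.
move=> [c Cc] clC midC; pose E := [set `|v - p| ^+ 2 | v in C].
have Einf : has_inf E.
  by split; [exists (`|c - p| ^+ 2), c | exists 0 => _ [v _ <-]; rewrite sqr_ge0].
pose d := inf E.
have dP v : C v -> d <= `|v - p| ^+ 2.
  by move=> Cv; apply: ge_inf; [exact: Einf.2|exists v].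
have /choice[u uP] : forall n : nat, exists u, C u /\ `|u - p| ^+ 2 < d + n.+1%:R^-1.
  move=> n; have [|_ [u Cu <-] lt] := @inf_adherent _ E n.+1%:R^-1 _ Einf.
    by rewrite invr_gt0.
  by exists u.
have near_min m n : (m <= n)%N -> `|u m - u n| ^+ 2 <= 4 * m.+1%:R^-1.
  move=> mn; have [[Cm um] [Cn un]] := (uP m, uP n).
  have /dP := midC _ _ Cm Cn.
  rewrite midpointB normrZ exprMn ger0_norm ?invr_ge0// => dm.
  have := parallelogram_law (u m - p) (u n - p).
  have -> : u m - p - (u n - p) = u m - u n by rewrite opprB addrA subrK.
  have nm : n.+1%:R^-1 <= m.+1%:R^-1 :> R by rewrite lef_pV2 ?posrE// ler_nat.
  move: dm um un nm; rewrite expr2.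
  move: (m.+1%:R^-1) (n.+1%:R^-1) => a b; lra.
have cvu : cvg (u n @[n --> \oo]).
  apply: (cvg_of_sq_dist_le _ near_min).
  rewrite -[X in _ --> X](mulr0 4); apply: cvgMr; exact: cvg_harmonic.
exists (lim (u n @[n --> \oo])); split.
  by apply: (closed_cvg _ clC _ _ cvu); near=> n; exact: (uP n).1.
move=> v Cv; rewrite -ler_sqr ?nnegrE//; apply: le_trans (dP v Cv).
have lim_sq : `|u n - p| ^+ 2 @[n --> \oo] --> `|lim (u n @[n --> \oo]) - p| ^+ 2.
  by rewrite expr2; under eq_fun do rewrite expr2;
     apply: cvgM; apply: cvg_norm; apply: cvgB => //; exact: cvg_cst.
have lim_d : (d + n.+1%:R^-1) @[n --> \oo] --> d.
  by rewrite -[X in _ --> X]addr0; apply: cvgD; [exact: cvg_cst|exact: cvg_harmonic].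
apply: (ler_cvg_to lim_sq lim_d).
by near=> n; exact/ltW/(uP n).2.
Unshelve. all: by end_near. Qed.

Lemma nearest_point_unique (C : set H) p u v :
  (forall w, C w -> `|u - p| <= `|w - p|) -> C (2^-1 *: (u + v)) ->
  `|v - p| <= `|u - p| -> u = v.
Proof.
move=> umin Cm vu; have := umin _ Cm.
rewrite midpointB -ler_sqr ?nnegrE// normrZ exprMn ger0_norm ?invr_ge0// => um.
move: vu; rewrite -ler_sqr ?nnegrE// => vu.
have := parallelogram_law (u - p) (v - p).
have -> : u - p - (v - p) = u - v by rewrite opprB addrA subrK.
move=> par; apply/eqP; rewrite -subr_eq0 -normr_eq0 -sqrf_eq0 eq_le sqr_ge0 andbT.
lra.
Qed.

(** The representing vector is a multiple of the point of the affine
    hyperplane [f = 1] that is nearest to the origin. *)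
Lemma riesz_representation (f : H -> R) :
  scalar f -> continuous f -> exists g, forall h, f h = inner h g.
Proof.
move=> flin fcont.
have f0 : f 0 = 0 by have := flin (-1) 0 0; rewrite scaler0 addr0; lra.
have fZ a x : f (a *: x) = a * f x by have := flin a x 0; rewrite addr0 f0 addr0.
have fD x z : f (x + z) = f x + f z by have := flin 1 x z; rewrite scale1r mul1r.
have [fz|] := pselect (forall h, f h = 0).
  by exists 0 => h; rewrite fz -(scale0r (0 : H)) innerZr mul0r.
move=> /existsNP[h0 /eqP fh0].
pose C := f @^-1` [set 1].
have [|||u [Cu umin]] := @nearest_point_exists C 0.
- by exists ((f h0)^-1 *: h0); rewrite /C /= fZ mulVf.
- by apply: closed_comp => [x _|]; [exact: fcont|exact: closed_eq].
- by move=> u v; rewrite /C /= fZ fD => -> ->; rewrite mulVf ?pnatr_eq0.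
have u0 : u != 0.
  by apply/eqP => u0; move: Cu; rewrite /C /= u0 f0 => /eqP; rewrite eq_sym oner_eq0.
have orth k : f k = 0 -> inner u k = 0.
  move=> fk; apply: (@quadratic_ge0_linear_eq0 _ _ (`|k| ^+ 2)) => [|t].
    by rewrite sqr_ge0.
  have := umin (u + t *: k); rewrite /C /= fD fZ fk mulr0 addr0 => /(_ Cu).
  rewrite !subr0 -ler_sqr ?nnegrE// normD_sq innerZr normrZ exprMn.
  by rewrite real_normK ?num_real//; lra.
exists (`|u| ^- 2 *: u) => h.
have /orth : f (h - f h *: u) = 0.
  by rewrite -scaleNr fD fZ (Cu : f u = 1); ring.
rewrite innerDr innerNr !innerZr inner_normE (innerC h) => /eqP.
rewrite subr_eq0 => /eqP ->.
by rewrite mulrCA mulVf ?mulr1// sqrf_eq0 normr_eq0.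
Qed.

End Inner.

(** * Bounded linear maps and adjoints *)

Section LinearMaps.
Context {R : realType}.

Lemma opnorm_bound (X Y : normedModType R) (A : {linear X -> Y}) h :
  continuous A -> `|A h| <= opnorm A * `|h|.
Proof.
move=> cA; have [->|h0] := eqVneq h 0; first by rewrite linear0 !normr0 mulr0.
have [M Mb] : exists M, forall x : X, `|A x| <= M * `|x|.
  have /linear_boundedP[r [_ rb]] : bounded_near A (nbhs 0).
    by apply: continuous_linear_bounded; exact: cA.
  by exists (r + 1); apply: rb; lra.
have nh : 0 < `|h| by rewrite normr_gt0.
rewrite -ler_pdivrMr//; have -> : `|A h| / `|h| = `|A (`|h|^-1 *: h)|.
  by rewrite linearZ normrZ ger0_norm ?invr_ge0// mulrC.
apply: ub_le_sup; last first.
  exists (`|h|^-1 *: h) => //=.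
  by rewrite normrZ ger0_norm ?invr_ge0// mulVf ?normr_eq0.
exists `|M| => _ [x /= x1 <-]; apply: le_trans (Mb x) _.
apply: le_trans (ler_wpM2r _ (ler_norm M)) _ => //.
by rewrite -[leRHS]mulr1 ler_wpM2l.
Qed.

Lemma opnorm_ge0 (X Y : normedModType R) (A : X -> Y) : 0 <= opnorm A.
Proof.
rewrite /opnorm; set E := (E in sup E).
have [[_ Eub]|/sup_out ->//] := pselect (has_sup E).
have E0 : E `|A 0| by exists 0; rewrite //= normr0.
by apply: le_trans (ub_le_sup Eub E0).
Qed.

Context {X Y : hilbertType R}.

Lemma adjointP (A : {linear X -> Y}) h k :
  continuous A -> inner (A h) k = inner h (adjoint A k).
Proof.
move=> cA; rewrite /adjoint; set S := (S in get S).
suff /getPex : exists B, S B by exact.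
have /choice[B BP] : forall k, exists b, forall h, inner (A h) k = inner h b.
  move=> {}k; apply: riesz_representation => [a u v|].
    by rewrite linearP innerDl innerZl.
  move=> x; apply/cvgrPdist_lt => e e0.
  have k1 : 0 < `|k| + 1 by rewrite ltr_wpDl.
  have := cA x; move=> /cvgrPdist_lt /(_ (e / (`|k| + 1)) _).
  move=> /(_ (divr_gt0 e0 k1)); apply: filterS => z zx.
  rewrite -innerNl -innerDl; apply: le_lt_trans (cauchy_schwarz _ _) _.
  apply: (@le_lt_trans _ _ (`|A x - A z| * (`|k| + 1))).
    by rewrite ler_wpM2l// lerDl.
  by rewrite -ltr_pdivlMr.
by exists B => {}h {}k; exact: BP.
Qed.

Lemma adjoint_norm_le (A : {linear X -> Y}) (c : R) k :
  continuous A -> 0 <= c -> (forall h, `|A h| <= c * `|h|) ->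
  `|adjoint A k| <= c * `|k|.
Proof.
move=> cA c0 Ac; set v := adjoint A k.
have [->|v0] := eqVneq v 0.
  by rewrite normr0 mulr_ge0.
rewrite -(@ler_pM2l _ `|v|) ?normr_gt0// -expr2 -inner_normE -adjointP//.
apply: le_trans (ler_norm _) _; apply: le_trans (cauchy_schwarz _ _) _.
by rewrite mulrA (mulrC _ c) ler_wpM2r.
Qed.

End LinearMaps.

(** * A single operator under the tangential cone condition *)

Section TangentialCone.
Context {R : realType} {X Y : hilbertType R} {D B : set X} {f : X -> Y} {eta : R}.
Hypothesis f_diff : forall x, B x -> differentiable_in D f x.
Hypothesis f_scale : forall x, B x -> opnorm (deriv_in D f x) <= 1.
Hypothesis f_cone : tangential_cone D B f eta.
Local Notation df := (deriv_in D f).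

Lemma deriv_inB x u v : df x (u - v) = df x u - df x v.
Proof. by rewrite /deriv_in linearB. Qed.

Lemma deriv_in_continuous x : B x -> continuous (df x).
Proof. by move=> Bx; exact: diff_continuous (f_diff Bx). Qed.

Lemma deriv_in_norm_le x h : B x -> `|df x h| <= `|h|.
Proof.
move=> Bx; have := opnorm_bound h (@deriv_in_continuous x Bx).
by move=> /le_trans; apply; rewrite ler_piMl//; exact: f_scale.
Qed.

Lemma adjoint_derivP x h k : B x -> inner (df x h) k = inner h (adjoint (df x) k).
Proof. by move=> Bx; apply: adjointP; exact: deriv_in_continuous. Qed.

Lemma adjoint_deriv_norm_le x k : B x -> `|adjoint (df x) k| <= `|k|.
Proof.
move=> Bx; rewrite -[leRHS]mul1r; apply: adjoint_norm_le => // [|h].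
  exact: deriv_in_continuous.
by rewrite mul1r; exact: deriv_in_norm_le.
Qed.

(** The adjoint is a chosen function known only through its pairing with [df x];
    nondegeneracy of the inner product makes it additive. *)
Lemma adjoint_derivB x u v : B x ->
  adjoint (df x) (u - v) = adjoint (df x) u - adjoint (df x) v.
Proof.
move=> Bx; apply/eqP; rewrite -subr_eq0 -normr_eq0 -sqrf_eq0 -inner_normE.
set w := (X in inner X X); rewrite {2}/w !innerDr !innerNr innerDr innerNr.
rewrite -!adjoint_derivP// innerDr innerNr; apply/eqP; ring.
Qed.

Lemma adjoint_deriv_dist_le x z k : B x -> B z ->
  `|adjoint (df x) k - adjoint (df z) k| <= opnorm (fun h => df x h - df z h) * `|k|.
Proof.
move=> Bx Bz; set v := _ - _.
have cont : continuous (df x \- df z).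
  by move=> h; apply: continuousB; exact: deriv_in_continuous.
pose A : {linear X -> Y} := ('d f (within D (nbhs x)) \- 'd f (within D (nbhs z)))%R.
have Av : `|df x v - df z v| <= opnorm (fun h => df x h - df z h) * `|v|.
  exact: (@opnorm_bound _ _ _ A).
have [->|v0] := eqVneq v 0.
  by rewrite normr0 mulr_ge0// opnorm_ge0.
rewrite -(@ler_pM2l _ `|v|) ?normr_gt0// -expr2 -inner_normE {2}/v.
rewrite innerDr innerNr -!adjoint_derivP// -innerNl -innerDl.
apply: le_trans (ler_norm _) _; apply: le_trans (cauchy_schwarz _ _) _.
by rewrite mulrA (mulrC `|v|) ler_wpM2r.
Qed.

Lemma deriv_le_increment x z : B x -> B z ->
  `|df x (x - z)| <= (1 + eta) * `|f x - f z|.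
Proof.
move=> Bx Bz; have := f_cone Bx Bz.
set a := f x - f z; set b := df x _ => h.
have : `|b| <= `|a| + `|a - b|.
  by rewrite -[in leLHS](subKr a b); apply: le_trans (ler_normB _ _) _.
by lra.
Qed.

Lemma increment_le_deriv x z : B x -> B z ->
  (1 - eta) * `|f x - f z| <= `|df x (x - z)|.
Proof.
move=> Bx Bz; have := f_cone Bx Bz.
set a := f x - f z; set b := df x _ => h.
have : `|a| <= `|b| + `|a - b|.
  by rewrite -[in leLHS](subrK b a) addrC; apply: ler_normD.
by lra.
Qed.

Lemma increment_eq0_of_neg x z : eta < 0 -> B x -> B z -> f x = f z.
Proof.
move=> eta_lt0 Bx Bz; have := le_trans (normr_ge0 _) (f_cone Bx Bz).
by rewrite nmulr_rge0// normr_le0 subr_eq0 => /eqP.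
Qed.

Hypothesis eta_lt : eta < 1 / 2.

(** The constant is an upper bound of [1 / (1 - eta)]. *)
Lemma increment_le_dist x z : B x -> B z -> `|f x - f z| <= 2 * `|x - z|.
Proof.
move=> Bx Bz; have := increment_le_deriv Bx Bz.
have := deriv_in_norm_le (x - z) Bx.
have : 0 <= (1 / 2 - eta) * `|f x - f z| by rewrite mulr_ge0// subr_ge0 ltW.
rewrite !mulrBl mul1r; set c := eta * _; set a := `|f x - f z|.
by set b := `|deriv_in _ _ _ _|; set d := `|x - z|; lra.
Qed.

(** Consequently a level set of [f] in [B] is the intersection of [B] with an
    affine subspace, so solutions in a ball form a convex set. *)
Lemma deriv_eq0P x z : B x -> B z -> df x (x - z) = 0 <-> f x = f z.
Proof.
move=> Bx Bz; split => [d0|fxz].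
- have := increment_le_deriv Bx Bz; rewrite d0 normr0.
  rewrite pmulr_rle0 ?normr_le0 ?subr_eq0; first by move/eqP.
  by rewrite subr_gt0; move: eta_lt; lra.
- have := deriv_le_increment Bx Bz; rewrite fxz subrr normr0 mulr0 normr_le0.
  by move/eqP.
Qed.

(** Up to terms controlled by the cone condition, [df x (x - xs)] is the
    residual, so a step along minus its adjoint image has negative inner product
    with the error [x - xs]; an active step has a residual above [tau * delta],
    and the lower bound on [tau] makes the negative term dominate. *)
Lemma step_descent x xs yd delta tau :
  0 <= eta -> 2 * ((1 + eta) / (1 - 2 * eta)) < tau ->
  B x -> B xs -> `|yd - f xs| <= delta ->
  let r := f x - yd in let w := loping r (tau * delta) in
  `|x - w *: adjoint (df x) r - xs| ^+ 2 +
    (1 - 2 * eta - 2 * (1 + eta) / tau) * (w * `|r| ^+ 2) <= `|x - xs| ^+ 2.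
Proof.
move=> eta0 htau Bx Bxs yd_err; cbv zeta.
set r := f x - yd; set w := loping r _.
have tau0 : 0 < tau.
  apply: le_lt_trans htau; rewrite mulr_ge0// divr_ge0//; first by lra.
  by move: eta_lt; lra.
rewrite {}/w /loping; case: ifPn => [tr|_]; last first.
  by rewrite scale0r subr0 mul0r mulr0 addr0.
rewrite scale1r mul1r; have := adjoint_deriv_norm_le r Bx.
set v := adjoint _ _ => vr; rewrite (addrAC x) (normB_sq (x - xs)).
have v2 : `|v| ^+ 2 <= `|r| ^+ 2 by rewrite ler_sqr ?nnegrE.
have -> : inner (x - xs) v = inner (df x (x - xs)) r by rewrite adjoint_derivP.
set a := f x - f xs; have cone := f_cone Bx Bxs; rewrite -/a in cone.
have a_r : a = r + (yd - f xs) by rewrite /a /r addrA subrK.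
have na : `|a| <= `|r| + delta.
  by rewrite a_r; apply: le_trans (ler_normD _ _) _; rewrite lerD2l.
have -> : df x (x - xs) = r - ((a - df x (x - xs)) - (yd - f xs)).
  by rewrite opprB addrA -a_r subKr.
set p := a - _; set q := yd - _.
rewrite innerDl innerNl innerDl innerNl inner_normE.
have pr : inner p r <= eta * (`|r| + delta) * `|r|.
  apply: le_trans (ler_norm _) _; apply: le_trans (cauchy_schwarz _ _) _.
  by rewrite ler_wpM2r//; apply: le_trans cone _; rewrite ler_wpM2l.
have qr : - inner q r <= delta * `|r|.
  apply: le_trans (ler_norm _) _; rewrite normrN.
  by apply: le_trans (cauchy_schwarz _ _) _; rewrite ler_wpM2r.
have dr : delta * `|r| <= `|r| ^+ 2 / tau.
  by rewrite ler_pdivlMr// mulrAC expr2 ler_wpM2r// mulrC ltW.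
have drE : (1 + eta) * (delta * `|r|) <= (1 + eta) * (`|r| ^+ 2 / tau).
  by rewrite ler_wpM2l//; lra.
have -> : (1 - 2 * eta - 2 * (1 + eta) / tau) * `|r| ^+ 2 =
    (1 - 2 * eta) * `|r| ^+ 2 - 2 * ((1 + eta) * (`|r| ^+ 2 / tau)) by ring.
by move: pr v2; rewrite [eta * (_ + _) * _]mulrAC mulrDr; lra.
Qed.

End TangentialCone.

(** * The loping iteration *)

Section Iteration.
Context {R : realType} {X Y : hilbertType R} {N : nat} (hN : (0 < N)%N).
Context (D : 'I_N -> set X) (F : 'I_N -> X -> Y) (y : 'I_N -> Y).
Context (x0 : X) (rho eta tau : R).
Local Notation B := (closed_ball x0 rho).
Local Notation iter yd delta := (lLK hN D F yd delta tau x0).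

Definition residual (yd : 'I_N -> Y) (delta : 'I_N -> R) (n : nat) : Y :=
  F (cyc hN n) (iter yd delta n) - yd (cyc hN n).

Definition relaxation (yd : 'I_N -> Y) (delta : 'I_N -> R) (n : nat) : R :=
  loping (residual yd delta n) (tau * delta (cyc hN n)).

Lemma lLKS yd delta n : iter yd delta n.+1 = iter yd delta n -
  relaxation yd delta n *: adjoint (deriv_in (D (cyc hN n)) (F (cyc hN n))
    (iter yd delta n)) (residual yd delta n).
Proof. by []. Qed.

Lemma cyc_mulnD c n : cyc hN (c * N + n) = cyc hN n.
Proof. by apply: val_inj; rewrite /= modnMDl. Qed.

Lemma cyc_modn n : cyc hN (n %% N) = cyc hN n.
Proof. by apply: val_inj; rewrite /= modn_mod. Qed.

Lemma cyc_ord (i : 'I_N) : cyc hN i = i.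
Proof. by apply: val_inj; rewrite /= modn_small. Qed.

(** The update depends on the iterate and on the index modulo [N] only. *)
Lemma stationary_cycle_forever yd delta n :
  stationary_cycle N (iter yd delta) n ->
  forall m, (n <= m)%N -> iter yd delta m = iter yd delta n.
Proof.
move=> [/dvdnP[c ->] stat] m0 /subnKC <-.
elim: (m0 - c * N)%N => [|m IH]; first by rewrite addn0.
rewrite -(stat (m %% N).+1) ?ltn_pmod// !addnS !lLKS /relaxation /residual.
by rewrite !cyc_mulnD cyc_modn IH (stat (m %% N)%N) // ltnW// ltn_pmod.
Qed.

Lemma relaxation_eq0 yd delta n : relaxation yd delta n = 0 ->
  iter yd delta n.+1 = iter yd delta n.
Proof. by rewrite lLKS => ->; rewrite scale0r subr0. Qed.

Lemma relaxation_neq0 yd delta n : relaxation yd delta n != 0 ->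
  relaxation yd delta n = 1 /\
  tau * delta (cyc hN n) < `|residual yd delta n|.
Proof. by rewrite /relaxation /loping; case: ifP => //; rewrite eqxx. Qed.

Lemma not_stationary_active yd delta c :
  ~ stationary_cycle N (iter yd delta) (c * N) ->
  exists2 j, (j < N)%N & relaxation yd delta (c * N + j) != 0.
Proof.
apply: contra_notP => nex.
have inact j : (j < N)%N -> relaxation yd delta (c * N + j) = 0.
  by move=> jN; apply/eqP/negPn/negP => act; apply: nex; exists j.
split; first exact: dvdn_mull.
elim=> [|j IH] jN; first by rewrite addn0.
by rewrite addnS relaxation_eq0 ?IH ?inact// ltnW.
Qed.

Lemma relaxation_ge0 yd delta n : 0 <= relaxation yd delta n.
Proof. by rewrite /relaxation /loping; case: ifP. Qed.

Hypothesis hrho : 0 < rho.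
Hypothesis hD : forall i, B `<=` D i.
Hypothesis hdiff : forall i x, B x -> differentiable_in (D i) (F i) x.
Hypothesis hscale :
  forall i x, B x -> opnorm (deriv_in (D i) (F i) x) <= 1.
Hypothesis hcone : forall i, tangential_cone (D i) B (F i) eta.
Hypothesis eta_lt : eta < 1 / 2.
Context (xs0 : X).
Hypothesis xs0_ball : closed_ball x0 (rho / 2) xs0.
Hypothesis xs0_sol : is_solution D F y xs0.

Lemma solution_in_ball : B xs0.
Proof.
have r2 : 0 < rho / 2 by rewrite divr_gt0.
by move: xs0_ball; rewrite !mem_ballE// => h; apply: le_trans h _; move: hrho; lra.
Qed.

Lemma ball_sub_solution x : `|x - xs0| <= `|x0 - xs0| -> B x.
Proof.
move=> xx; have r2 : 0 < rho / 2 by rewrite divr_gt0.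
move: xs0_ball; rewrite !mem_ballE// => h.
have -> : x - x0 = (x - xs0) + (xs0 - x0) by rewrite addrA subrK.
apply: le_trans (ler_normD _ _) _.
by rewrite (distrC x0) in xx; lra.
Qed.

(** ** Solutions in the ball and the one nearest to the starting value *)

Definition ball_solutions := [set x | B x /\ is_solution D F y x].

Lemma ball_solutions_midpoint u v :
  ball_solutions u -> ball_solutions v -> ball_solutions (2^-1 *: (u + v)).
Proof.
move=> [Bu su] [Bv sv].
have Bm : B (2^-1 *: (u + v)).
  move: Bu Bv; rewrite !mem_ballE// midpointB normrZ ger0_norm ?invr_ge0// => hu hv.
  by have := ler_normD (u - x0) (v - x0); lra.
split=> // i; split; first exact: hD.
rewrite -(su i).2; apply/esym/(deriv_eq0P (@hcone i) eta_lt Bu Bm).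
have -> : u - 2^-1 *: (u + v) = 2^-1 *: (u - v).
  by rewrite -opprB midpointB subrr add0r -scalerN opprB.
rewrite /deriv_in linearZ/=.
have /(deriv_eq0P (@hcone i) eta_lt Bu Bv) : F i u = F i v by rewrite (su i).2 (sv i).2.
by rewrite /deriv_in => ->; rewrite scaler0.
Qed.

Lemma ball_solutions_closed : closed ball_solutions.
Proof.
move=> x clx.
have Bx : B x.
  by apply: closed_ball_closed => A /clx[z [[Bz _] Az]]; exists z.
split=> // i; split; first exact: hD.
apply/eqP; rewrite -subr_eq0 -normr_le0 leNgt; apply/negP => gt0.
have /clx[z [[Bz sz] /=]] : nbhs x (ball x (`|F i x - y i| / 2)).
  by apply: nbhsx_ballx; rewrite divr_gt0.
rewrite -ball_normE /= -(sz i).2 ltr_pdivlMr// mulrC ltNge.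
by rewrite (increment_le_dist (@hdiff i) (@hscale i) (@hcone i)).
Qed.

Lemma min_dist_in_ball xd : is_min_dist_solution D F y x0 xd -> B xd.
Proof.
move=> [_ /(_ _ xs0_sol) le]; have := solution_in_ball.
by rewrite !mem_ballE//; exact: le_trans.
Qed.

Lemma min_dist_solution_unique_exists :
  exists xd, unique (is_min_dist_solution D F y x0) xd.
Proof.
have [|xd [[Bxd sxd] xd_min]] := @nearest_point_exists _ _ ball_solutions x0
    _ ball_solutions_closed ball_solutions_midpoint.
  by exists xs0; split => //; exact: solution_in_ball.
have min_xd : is_min_dist_solution D F y x0 xd.
  split=> // z sz; have [Bz|] := pselect (B z); first exact: xd_min.
  rewrite mem_ballE// => /negP; rewrite -ltNge => /ltW; apply: le_trans.
  by rewrite -mem_ballE.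
exists xd; split=> // z minz; have Bz := min_dist_in_ball minz.
apply: (@nearest_point_unique _ _ ball_solutions x0) => //.
- by apply: ball_solutions_midpoint; split => //; exact: minz.1.
- exact: minz.2.
Qed.

Section Monotone.
Hypothesis eta0 : 0 <= eta.
Hypothesis tau_gt : 2 * ((1 + eta) / (1 - 2 * eta)) < tau.

(** Multiple of the squared residual by which an active step lowers the squared
    distance to a solution. *)
Definition descent_rate : R := 1 - 2 * eta - 2 * (1 + eta) / tau.

Lemma tau_gt0 : 0 < tau.
Proof.
apply: le_lt_trans tau_gt; rewrite mulr_ge0// divr_ge0//.
  by move: eta0; lra.
by move: eta_lt; lra.
Qed.

Lemma descent_rate_gt0 : 0 < descent_rate.
Proof.
have e1 : 0 < 1 - 2 * eta by move: eta_lt; lra.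
rewrite /descent_rate subr_gt0 ltr_pdivrMr ?tau_gt0//.
by move: tau_gt; rewrite mulrA ltr_pdivrMr// (mulrC tau).
Qed.

(** ** Monotonicity and termination *)

Section PerturbedData.
Context (yd : 'I_N -> Y) (delta : 'I_N -> R).
Hypothesis yd_err : forall i, `|yd i - y i| <= delta i.
Local Notation x_ := (iter yd delta).

Lemma lLK_step_descent xs n : B xs -> is_solution D F y xs -> B (x_ n) ->
  `|x_ n.+1 - xs| ^+ 2 +
    descent_rate * (relaxation yd delta n * `|residual yd delta n| ^+ 2)
  <= `|x_ n - xs| ^+ 2.
Proof.
move=> Bxs sol Bn; rewrite lLKS; set i := cyc hN n.
have err : `|yd i - F i xs| <= delta i by rewrite (sol i).2.
exact: (step_descent (@hdiff i) (@hscale i) (@hcone i) eta_lt eta0 tau_gt Bn Bxs err).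
Qed.

Lemma lLK_step_le xs n : B xs -> is_solution D F y xs -> B (x_ n) ->
  `|x_ n.+1 - xs| <= `|x_ n - xs|.
Proof.
move=> Bxs sol Bn; rewrite -ler_sqr ?nnegrE//.
apply: le_trans (lLK_step_descent Bxs sol Bn); rewrite lerDl.
by rewrite mulr_ge0 ?(ltW descent_rate_gt0)// mulr_ge0 ?relaxation_ge0.
Qed.

Lemma lLK_in_ball n : B (x_ n).
Proof.
apply: ball_sub_solution; elim: n => [//|n IH].
apply: (le_trans _ IH); apply: lLK_step_le => //; first exact: solution_in_ball.
exact: ball_sub_solution.
Qed.

Lemma lLK_fejer xs m n : B xs -> is_solution D F y xs -> (m <= n)%N ->
  `|x_ n - xs| <= `|x_ m - xs|.
Proof.
move=> Bxs sol /subnKC <-; elim: (n - m)%N => [|k IH]; first by rewrite addn0.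
by rewrite addnS; apply: le_trans IH; apply: lLK_step_le => //; exact: lLK_in_ball.
Qed.

(** Every active step lowers the squared distance to a solution by a fixed
    amount, so some cycle contains no active step. *)
Lemma lLK_stationary_cycle : (forall i, 0 < delta i) ->
  exists c, stationary_cycle N x_ (c * N).
Proof.
move=> delta_gt0; apply: contrapT => /forallNP nstat.
have [mu mu0 muP] : exists2 mu, 0 < mu &
    forall i, mu <= descent_rate * (tau * delta i) ^+ 2.
  exists (\big[Num.min/1]_i (descent_rate * (tau * delta i) ^+ 2)).
    apply: lt_bigmin => [|i _]; first exact: ltr01.
    by rewrite mulr_gt0 ?descent_rate_gt0// exprn_gt0// mulr_gt0 ?tau_gt0.
  by move=> i; exact: bigmin_le.
pose E c := `|x_ (c * N) - xs0| ^+ 2.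
have sol_ball := solution_in_ball.
have drop c : E c.+1 <= E c - mu.
  have [j jN act] := not_stationary_active (nstat c).
  have [w1 r_gt] := relaxation_neq0 act.
  have := lLK_step_descent sol_ball xs0_sol (@lLK_in_ball (c * N + j)).
  rewrite w1 mul1r => step.
  have pre : `|x_ (c * N + j) - xs0| ^+ 2 <= E c.
    by rewrite ler_sqr ?nnegrE//; apply: lLK_fejer => //; rewrite leq_addr.
  have post : E c.+1 <= `|x_ (c * N + j).+1 - xs0| ^+ 2.
    rewrite ler_sqr ?nnegrE//; apply: lLK_fejer => //.
    by rewrite mulSnr -addnS leq_add2l.
  have gain : mu <= descent_rate * `|residual yd delta (c * N + j)| ^+ 2.
    apply: le_trans (muP (cyc hN (c * N + j))) _.
    rewrite ler_wpM2l ?(ltW descent_rate_gt0)// ler_sqr ?nnegrE//; first exact: ltW.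
    by rewrite mulr_ge0 ?(ltW tau_gt0)// ltW.
  lra.
have Ec c : E c <= E 0 - c%:R * mu.
  elim: c => [|c IH]; first by rewrite mul0r subr0.
  by rewrite -natr1 mulrDl mul1r; have := drop c; lra.
have E0 : 0 <= E 0 / mu by rewrite divr_ge0 ?(ltW mu0)// sqr_ge0.
have := archi_boundP E0; rewrite ltr_pdivrMr//.
have := Ec (Num.bound (E 0 / mu)).
have : 0 <= E (Num.bound (E 0 / mu)) by rewrite sqr_ge0.
by set a := _ * mu; lra.
Qed.

Lemma lLK_terminates : (forall i, 0 < delta i) ->
  exists n, is_termination_index N x_ n.
Proof.
move=> /lLK_stationary_cycle[c cP].
have ex : exists n, `[< stationary_cycle N x_ n >].
  by exists (c * N)%N; apply/asboolP.
exists (ex_minn ex); case: ex_minnP => n /asboolP nP nmin; split => // m mP.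
by apply: nmin; apply/asboolP.
Qed.

End PerturbedData.

(** ** Strong convergence for exact data *)

Section ExactData.
Local Notation x_ := (iter y (fun=> 0)).
Local Notation r_ := (residual y (fun=> 0)).

Lemma exact_data_err i : `|y i - y i| <= (fun=> 0 : R) i.
Proof. by rewrite subrr normr0. Qed.

Lemma exact_in_ball n : B (x_ n).
Proof. exact: lLK_in_ball exact_data_err n. Qed.

Lemma exact_fejer xs m n : B xs -> is_solution D F y xs -> (m <= n)%N ->
  `|x_ n - xs| <= `|x_ m - xs|.
Proof. exact: lLK_fejer exact_data_err xs m n. Qed.

Lemma exact_step n : x_ n.+1 = x_ n -
  adjoint (deriv_in (D (cyc hN n)) (F (cyc hN n)) (x_ n)) (r_ n).
Proof.
rewrite lLKS /relaxation /loping mulr0 normr_gt0.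
have [r0|] := eqVneq (r_ n) 0; last by rewrite scale1r.
rewrite scale0r r0; congr (_ - _); apply/eqP; rewrite eq_sym -normr_le0.
have := adjoint_deriv_norm_le (@hdiff _) (@hscale (cyc hN n)) 0 (@exact_in_ball n).
by rewrite normr0.
Qed.

Lemma exact_descent xs n : B xs -> is_solution D F y xs ->
  `|x_ n.+1 - xs| ^+ 2 + descent_rate * `|r_ n| ^+ 2 <= `|x_ n - xs| ^+ 2.
Proof.
move=> Bxs sol.
apply: le_trans (lLK_step_descent exact_data_err Bxs sol (@exact_in_ball n)).
rewrite lerD2l ler_wpM2l ?(ltW descent_rate_gt0)//.
rewrite /relaxation /loping mulr0; case: ifPn => [_|]; first by rewrite mul1r.
by rewrite -leNgt normr_le0 => /eqP ->; rewrite normr0 expr0n mulr0.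
Qed.

Lemma exact_step_norm n : `|x_ n.+1 - x_ n| <= `|r_ n|.
Proof.
rewrite exact_step addrAC subrr sub0r normrN.
apply: (adjoint_deriv_norm_le (@hdiff _) (@hscale _)); exact: exact_in_ball.
Qed.

Definition cycle_start c := x_ (c * N).
Definition cycle_residual c : R := \sum_(s < N) `|r_ (c * N + s)|.
Local Notation z_ := cycle_start.
Local Notation R_ := cycle_residual.

Lemma cycle_residual_ge0 c : 0 <= R_ c.
Proof. exact: sumr_ge0. Qed.

Lemma residual_le_cycle c (s : 'I_N) : `|r_ (c * N + s)| <= R_ c.
Proof. by rewrite /R_ (bigD1 s)//= lerDl sumr_ge0. Qed.

Lemma dist_in_cycle c k : (k <= N)%N -> `|x_ (c * N + k) - z_ c| <= R_ c.
Proof.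
move=> kN; suff : `|x_ (c * N + k) - z_ c| <= \sum_(s < k) `|r_ (c * N + s)|.
  move=> /le_trans; apply; rewrite /R_ -(big_mkord xpredT (fun s => `|r_ (c * N + s)|)).
  rewrite -(big_mkord xpredT (fun s => `|r_ (c * N + s)|)).
  by rewrite [leRHS](@big_cat_nat _ _ _ k)//= lerDl sumr_ge0.
elim: k {kN} => [|k IH]; first by rewrite addn0 subrr normr0 big_ord0.
rewrite big_ord_recr/= addnS -(subrK (x_ (c * N + k)) (x_ _.+1)) -addrA addrC.
by apply: le_trans (ler_normD _ _) _; apply: lerD => //; exact: exact_step_norm.
Qed.

(** The cycle starts at [z_ c], but the equation of index [s] is only touched
    [s] steps later; the two residuals differ by the distance travelled. *)
Lemma start_residual_le c i : `|F i (z_ c) - y i| <= 3 * R_ c.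
Proof.
have -> : F i (z_ c) - y i = (F i (z_ c) - F i (x_ (c * N + i))) + r_ (c * N + i).
  by rewrite /residual cyc_mulnD cyc_ord addrA subrK.
apply: le_trans (ler_normD _ _) _.
have := residual_le_cycle c i.
have : `|z_ c - x_ (c * N + i)| <= R_ c by rewrite distrC dist_in_cycle// ltnW.
have := increment_le_dist (@hdiff i) (@hscale i) (@hcone i) eta_lt
  (@exact_in_ball (c * N)) (@exact_in_ball (c * N + i)).
rewrite -/(z_ c); lra.
Qed.

Lemma cycle_descent xs c : B xs -> is_solution D F y xs ->
  descent_rate / N%:R * R_ c ^+ 2 <= `|z_ c - xs| ^+ 2 - `|z_ c.+1 - xs| ^+ 2.
Proof.
move=> Bxs sol; have N0 : 0 < N%:R :> R by rewrite ltr0n.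
have sum_le k : descent_rate * \sum_(s < k) `|r_ (c * N + s)| ^+ 2 <=
    `|z_ c - xs| ^+ 2 - `|x_ (c * N + k) - xs| ^+ 2.
  elim: k => [|k IH]; first by rewrite big_ord0 mulr0 addn0 subrr.
  rewrite big_ord_recr/= addnS mulrDr.
  by have := exact_descent (c * N + k) Bxs sol; lra.
rewrite /(z_ c.+1) mulSnr; apply: le_trans (sum_le N).
rewrite mulrAC -mulrA ler_wpM2l ?(ltW descent_rate_gt0)//.
by rewrite ler_pdivrMr// mulrC sqr_sum_le.
Qed.

(** Pairing an update with an error transfers the adjoint: the update of step
    [c * N + k] only sees the image of [z_ n - xs] under the derivative there,
    which the cone condition bounds by residuals. Choosing [n] with the smallest
    cycle residual makes the bound quadratic in [R_ c]. *)
Lemma inner_cycle_le xs n c : B xs -> is_solution D F y xs -> R_ n <= R_ c ->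
  `|inner (z_ c.+1 - z_ c) (z_ n - xs)| <= 8 * R_ c ^+ 2.
Proof.
move=> Bxs sol Rnc.
have step (k : 'I_N) : `|inner (x_ (c * N + k).+1 - x_ (c * N + k)) (z_ n - xs)| <=
    8 * R_ c * `|r_ (c * N + k)|.
  have Bk := @exact_in_ball (c * N + k); have Bn := @exact_in_ball (n * N).
  rewrite exact_step addrAC subrr sub0r innerNl normrN innerC.
  rewrite -(adjoint_derivP (@hdiff _))//; rewrite cyc_mulnD cyc_ord.
  apply: le_trans (cauchy_schwarz _ _) _; rewrite ler_wpM2r//.
  have -> : z_ n - xs = (x_ (c * N + k) - xs) - (x_ (c * N + k) - z_ n).
    by rewrite opprB [RHS]addrC addrA subrK.
  rewrite deriv_inB; apply: le_trans (ler_normB _ _) _.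
  have := deriv_le_increment (@hcone k) Bk Bxs.
  have := deriv_le_increment (@hcone k) Bk Bn.
  rewrite (sol k).2 -/(z_ n).
  have rk : `|F k (x_ (c * N + k)) - y k| <= R_ c.
    by have := residual_le_cycle c k; rewrite /residual cyc_mulnD cyc_ord.
  have rkn : `|F k (x_ (c * N + k)) - F k (z_ n)| <= 4 * R_ c.
    have -> : F k (x_ (c * N + k)) - F k (z_ n) =
        (F k (x_ (c * N + k)) - y k) - (F k (z_ n) - y k).
      by rewrite opprB addrA subrK.
    apply: le_trans (ler_normB _ _) _.
    by have := start_residual_le n k; lra.
  (* [1 + eta <= 3 / 2], and [3 / 2 * (1 + 4)] is below the claimed [8] *)
  have : (1 + eta) * `|F k (x_ (c * N + k)) - F k (z_ n)| <= 3 / 2 * (4 * R_ c).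
    by apply: ler_pM => //; move: eta0 eta_lt; lra.
  have : (1 + eta) * `|F k (x_ (c * N + k)) - y k| <= 3 / 2 * R_ c.
    by apply: ler_pM => //; move: eta0 eta_lt; lra.
  have := cycle_residual_ge0 c; lra.
suff sum_le k : (k <= N)%N -> `|inner (x_ (c * N + k) - z_ c) (z_ n - xs)| <=
    8 * R_ c * \sum_(s < k) `|r_ (c * N + s)|.
  by have := sum_le N (leqnn N); rewrite -mulSnr expr2 mulrA.
elim: k => [_|k IH kN]; first by rewrite addn0 subrr linear0l normr0 big_ord0 mulr0.
rewrite big_ord_recr/= addnS -(subrK (x_ (c * N + k)) (x_ _.+1)) -addrA addrC.
rewrite innerDl mulrDr; apply: le_trans (ler_normD _ _) _.
by apply: lerD; [exact: IH (ltnW kN)|exact: (step (Ordinal kN))].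
Qed.

Lemma inner_range_le xs n m p : B xs -> is_solution D F y xs -> (m <= p)%N ->
  (forall c, (m <= c < p)%N -> R_ n <= R_ c) ->
  `|inner (z_ p - z_ m) (z_ n - xs)| <=
    8 * N%:R / descent_rate * (`|z_ m - xs| ^+ 2 - `|z_ p - xs| ^+ 2).
Proof.
move=> Bxs sol; elim: p => [|p IH].
  by rewrite leqn0 => /eqP -> _; rewrite !subrr linear0l normr0 mulr0.
rewrite leq_eqVlt => /predU1P[-> _|mp Rle].
  by rewrite !subrr linear0l normr0 mulr0.
have -> : z_ p.+1 - z_ m = (z_ p.+1 - z_ p) + (z_ p - z_ m) by rewrite addrA subrK.
rewrite innerDl; apply: le_trans (ler_normD _ _) _.
have K0 : 0 <= 8 * N%:R / descent_rate.
  by rewrite divr_ge0 ?mulr_ge0// ltW// descent_rate_gt0.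
have h1 : 8 * R_ p ^+ 2 <= 8 * N%:R / descent_rate *
    (`|z_ p - xs| ^+ 2 - `|z_ p.+1 - xs| ^+ 2).
  have := ler_wpM2l K0 (cycle_descent p Bxs sol).
  congr (_ <= _); field; rewrite pnatr_eq0 -lt0n hN.
  by rewrite gt_eqF ?descent_rate_gt0.
have h2 : `|inner (z_ p.+1 - z_ p) (z_ n - xs)| <= 8 * R_ p ^+ 2.
  by apply: inner_cycle_le => //; apply: Rle; rewrite ltnSn andbT.
have h3 : `|inner (z_ p - z_ m) (z_ n - xs)| <= 8 * N%:R / descent_rate *
    (`|z_ m - xs| ^+ 2 - `|z_ p - xs| ^+ 2).
  by apply: IH => // c /andP[mc cp]; apply: Rle; rewrite mc ltnW.
by move: h1 h2 h3; rewrite !mulrBr; lra.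
Qed.

(** Compare both cycle starts with the one of smallest residual between them:
    the mixed terms in the two expansions of squared distances are those bounded
    above, and the rest telescopes. *)
Lemma cycle_start_sq_dist_le xs m p : B xs -> is_solution D F y xs -> (m <= p)%N ->
  `|z_ m - z_ p| ^+ 2 <= (2 + 32 * N%:R / descent_rate) *
    (`|z_ m - xs| ^+ 2 - `|z_ p - xs| ^+ 2).
Proof.
move=> Bxs sol mp; have [n [/andP[mn np] nmin]] := exists_min_in_range R_ mp.
have /(inner_range_le Bxs sol mn) h1 : forall c, (m <= c < n)%N -> R_ n <= R_ c.
  move=> c /andP[mc cn].
  by apply: nmin; rewrite mc (leq_trans (ltnW cn)).
have /(inner_range_le Bxs sol np) h2 : forall c, (n <= c < p)%N -> R_ n <= R_ c.
  move=> c /andP[nc cp].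
  by apply: nmin; rewrite (ltnW cp) (leq_trans mn).
have e1 := normB_sq (z_ n - xs) (z_ n - z_ m).
have e2 := normD_sq (z_ n - xs) (z_ p - z_ n).
rewrite (_ : z_ n - xs - (z_ n - z_ m) = z_ m - xs) in e1; last first.
  by rewrite opprB addrC addrA subrK.
rewrite (_ : z_ n - xs + (z_ p - z_ n) = z_ p - xs) in e2; last first.
  by rewrite addrC addrA subrK.
have par := parallelogram_law (z_ n - z_ m) (z_ p - z_ n).
rewrite (_ : z_ n - z_ m + (z_ p - z_ n) = z_ p - z_ m) in par; last first.
  by rewrite addrC addrA subrK.
rewrite distrC.
have : `|z_ p - xs| ^+ 2 <= `|z_ n - xs| ^+ 2.
  by rewrite ler_sqr ?nnegrE//; apply: exact_fejer => //; rewrite leq_mul2r np orbT.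
have := sqr_ge0 `|z_ n - z_ m - (z_ p - z_ n)|.
move: (ler_norm (inner (z_ n - z_ m) (z_ n - xs))) h1.
move: (ler_norm (- inner (z_ p - z_ n) (z_ n - xs))) h2.
rewrite normrN (innerC (z_ p - z_ n)) (innerC (z_ n - z_ m)).
have -> : 32 * N%:R / descent_rate = 4 * (8 * N%:R / descent_rate) by ring.
by move: e1 e2 par; set K := 8 * _ / _; lra.
Qed.

Lemma exact_cvg_solution : exists xs,
  [/\ B xs, is_solution D F y xs & x_ n @[n --> \oo] --> xs].
Proof.
have sol_ball := solution_in_ball.
pose E c := `|z_ c - xs0| ^+ 2.
have E_dec m n : (m <= n)%N -> E n <= E m.
  move=> mn; rewrite ler_sqr ?nnegrE//; apply: exact_fejer => //.
  by rewrite leq_mul2r mn orbT.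
have E_cvg : cvg (E n @[n --> \oo]).
  apply: nonincreasing_is_cvgn => //; exists 0 => _ [n _ <-]; exact: sqr_ge0.
have E_ge n : lim (E c @[c --> \oo]) <= E n by exact: nonincreasing_cvgn_ge.
set l := lim _ in E_ge.
have tail_cvg0 K : (K * (E n - l)) @[n --> \oo] --> 0.
  rewrite -[X in _ --> X](mulr0 K) -(subrr l); apply: cvgMr.
  by apply: cvgB; [exact: E_cvg|exact: cvg_cst].
pose K := 2 + 32 * N%:R / descent_rate.
have K0 : 0 <= K.
  by rewrite addr_ge0// divr_ge0 ?mulr_ge0// ltW// descent_rate_gt0.
have z_cvg : cvg (z_ c @[c --> \oo]).
  apply: (cvg_of_sq_dist_le (tail_cvg0 K)) => m n mn.
  apply: le_trans (cycle_start_sq_dist_le sol_ball xs0_sol mn) _.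
  by rewrite ler_wpM2l// lerB// E_ge.
have R_cvg : R_ c @[c --> \oo] --> 0.
  apply: (cvg0_of_sq_le (tail_cvg0 (N%:R / descent_rate))) => c.
  have rate0 := descent_rate_gt0; have N0 : 0 < N%:R :> R by rewrite ltr0n.
  rewrite ger0_norm ?cycle_residual_ge0// -ler_pdivrMl ?divr_gt0// invf_div.
  apply: le_trans (cycle_descent c sol_ball xs0_sol) _.
  by rewrite lerB// E_ge.
pose xs := lim (z_ c @[c --> \oo]).
have Bxs : B xs.
  apply: (closed_cvg _ (@closed_ball_closed _ _ x0 rho) _ _ z_cvg).
  by near=> c; exact: exact_in_ball.
have z_xs : z_ c @[c --> \oo] --> xs by exact: z_cvg.
have d_cvg0 : `|z_ c - xs| @[c --> \oo] --> 0 by exact: dist_cvg0.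
exists xs; split => //.
- move=> i; split; first exact: hD.
  apply/eqP; rewrite -subr_eq0 -normr_le0.
  have bound_cvg0 : (2 * `|z_ c - xs| + 3 * R_ c) @[c --> \oo] --> 0.
    rewrite -[X in _ --> X](addr0 0) -{1}(mulr0 2) -{2}(mulr0 3).
    by apply: cvgD; apply: cvgMr.
  have bound c : `|F i xs - y i| <= 2 * `|z_ c - xs| + 3 * R_ c.
    rewrite -(subrK (F i (z_ c)) (F i xs)) -addrA.
    apply: le_trans (ler_normD _ _) _; apply: lerD; last exact: start_residual_le.
    rewrite distrC; apply: (increment_le_dist (@hdiff i) (@hscale i) (@hcone i)) => //.
    exact: exact_in_ball.
  apply: (ler_cvg_to (cvg_cst `|F i xs - y i|) bound_cvg0).
  by near=> c; exact: bound.
- have divN_cvg : (n %/ N)%N @[n --> \oo] --> \oo.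
    move=> A [k _ kA]; exists (k * N)%N => // n /= kn.
    by apply: kA; rewrite /= leq_divRL.
  have bound_cvg0 : (`|z_ c - xs| + R_ c) @[c --> \oo] --> 0.
    by rewrite -[X in _ --> X](addr0 0); apply: cvgD.
  apply: (@cvg_of_dist_le _ _ _ _ _ _ _
    (fun n => `|z_ (n %/ N)%N - xs| + R_ (n %/ N)%N)).
    exact: (cvg_comp _ _ divN_cvg bound_cvg0).
  near=> n; rewrite /= {1}(divn_eq n N).
  rewrite -(subrK (z_ (n %/ N)) (x_ _)) -addrA addrC.
  apply: le_trans (ler_normD _ _) _; apply: lerD => //.
  by apply: dist_in_cycle; rewrite ltnW// ltn_pmod.
Unshelve. all: by end_near. Qed.

(** Every update lies in the range of an adjoint, hence is orthogonal to the
    kernel of the corresponding derivative. *)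
Lemma exact_orthogonal v n :
  (forall i x, B x -> deriv_in (D i) (F i) x v = 0) ->
  inner (x_ n - x0) v = 0.
Proof.
move=> dv0; elim: n => [|n IH]; first by rewrite subrr linear0l.
rewrite exact_step addrAC innerDl IH innerNl innerC.
rewrite -(adjoint_derivP (@hdiff _)); last exact: exact_in_ball.
rewrite dv0; last exact: exact_in_ball.
by rewrite linear0l oppr0 addr0.
Qed.

(** The difference of the two solutions lies in all kernels at [xd], hence by the
    kernel condition in all kernels met by the iteration, so it is orthogonal to
    [xs - x0]; Pythagoras then contradicts minimality of [xd] unless both agree. *)
Lemma exact_limit_min_dist xs xd : B xs -> is_solution D F y xs ->
  x_ n @[n --> \oo] --> xs ->
  is_min_dist_solution D F y x0 xd -> kernel_condition D B F xd -> xs = xd.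
Proof.
move=> Bxs sol x_xs xdP kern; have Bxd := min_dist_in_ball xdP.
have dh i x : B x -> deriv_in (D i) (F i) x (xd - xs) = 0.
  move=> Bx; apply: (kern x i Bx); apply/(deriv_eq0P (@hcone i) eta_lt) => //.
  by rewrite (sol i).2 (xdP.1 i).2.
have orth : inner (xs - x0) (xd - xs) = 0.
  have inner_cvg : inner (x_ n - x0) (xd - xs) @[n --> \oo] --> inner (xs - x0) (xd - xs).
    apply: (@cvg_of_dist_le _ _ _ _ _ _ _ (fun n => `|x_ n - xs| * `|xd - xs|)).
      rewrite -[X in _ --> X](mul0r `|xd - xs|); apply: cvgMl; exact: dist_cvg0.
    near=> n; rewrite -innerNl -innerDl opprB addrA subrK; exact: cauchy_schwarz.
  have zero_cvg : inner (x_ n - x0) (xd - xs) @[n --> \oo] --> 0.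
    by apply: cvg_near_cst; apply: nearW => n; exact: exact_orthogonal.
  exact: (cvg_unique _ inner_cvg zero_cvg).
have := xdP.2 _ sol; rewrite -ler_sqr ?nnegrE//.
have := normD_sq (xs - x0) (xd - xs).
rewrite (_ : xs - x0 + (xd - xs) = xd - x0); last by rewrite addrC addrA subrK.
rewrite orth mulr0 addr0 => -> le.
apply/eqP; rewrite eq_sym -subr_eq0 -normr_eq0 -sqrf_eq0 eq_le sqr_ge0 andbT.
by move: le; rewrite gerDl.
Unshelve. all: by end_near. Qed.

End ExactData.

(** ** Limit of vanishing noise *)

Section NoisyData.
Local Notation x_ := (iter y (fun=> 0)).
Context (delta : nat -> 'I_N -> R) (yd : nat -> 'I_N -> Y).
Hypothesis noisy : forall k, is_noisy_data y (yd k) (delta k).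
Hypothesis noise_cvg0 :
  \big[Num.max/0]_(i < N) delta k i @[k --> \oo] --> (0 : R).
Hypothesis deriv_cont : forall i, continuous_deriv_on (D i) B (F i).
Local Notation xd_ k := (iter (yd k) (delta k)).

Lemma noisy_err k i : `|yd k i - y i| <= delta k i.
Proof. exact/ltW/(noisy k i).2. Qed.

Lemma delta_cvg0 i : delta k i @[k --> \oo] --> 0.
Proof.
apply: (squeeze_cvgr _ (cvg_cst 0) noise_cvg0).
by near=> k; rewrite ltW ?(noisy k i).1//=; exact: le_bigmax.
Unshelve. all: by end_near. Qed.

(** The loping switch is the only discontinuity of the step, and it is harmless:
    where the exact residual vanishes the noisy step is small whether taken or
    not, and elsewhere the noisy step is eventually taken. *)
Lemma noisy_iterate_cvg n : xd_ k n @[k --> \oo] --> x_ n.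
Proof.
elim: n => [|n IH]; first exact: cvg_cst.
have Bx := @exact_in_ball n; set x := x_ n in IH Bx.
have Bk k : B (xd_ k n) by exact: (lLK_in_ball (noisy_err k)).
set i := cyc hN n; set r := residual y (fun=> 0) n.
pose rd k := residual (yd k) (delta k) n.
have rd_cvg : rd k @[k --> \oo] --> r.
  apply: (@cvg_of_dist_le _ _ _ _ _ _ _ (fun k => 2 * `|xd_ k n - x| + delta k i)).
    rewrite -[X in _ --> X](addr0 0) -{1}(mulr0 2).
    by apply: cvgD; [apply: cvgMr; exact: dist_cvg0|exact: delta_cvg0].
  near=> k; have -> : rd k - r = (F i (xd_ k n) - F i x) - (yd k i - y i).
    by rewrite /rd /r /residual -/i -/x !opprB addrACA [RHS]addrACA (addrC (- F i x)).
  apply: le_trans (ler_normB _ _) _; apply: lerD; last exact: noisy_err.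
  exact: (increment_le_dist (@hdiff i) (@hscale i) (@hcone i)).
pose A z := adjoint (deriv_in (D i) (F i) z).
have A_le z k : B z -> `|A z k| <= `|k|.
  exact: (adjoint_deriv_norm_le (@hdiff i) (@hscale i)).
rewrite exact_step -/x -/i -/r.
under eq_fun do rewrite lLKS.
apply: cvgB => //.
apply: (@cvg_of_dist_le _ _ _ _ _ _ _ (fun k => `|rd k - r| +
  opnorm (fun h => deriv_in (D i) (F i) (xd_ k n) h - deriv_in (D i) (F i) x h) * `|r|)).
  rewrite -[X in _ --> X](addr0 0) -{2}(mul0r `|r|).
  apply: cvgD; first exact: dist_cvg0.
  apply: cvgMl; apply: (cvg_comp _ _ _ (@deriv_cont i _ Bx)) => U /IH.
  by rewrite /= !nbhs_simpl /=; apply: filterS => k; apply.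
have A_dist k : `|A (xd_ k n) (rd k) - A x r| <= `|rd k - r| +
    opnorm (fun h => deriv_in (D i) (F i) (xd_ k n) h - deriv_in (D i) (F i) x h) * `|r|.
  have -> : A (xd_ k n) (rd k) - A x r =
      A (xd_ k n) (rd k - r) + (A (xd_ k n) r - A x r).
    by rewrite /A (adjoint_derivB (@hdiff i) (rd k) r (Bk k)) addrA subrK.
  apply: le_trans (ler_normD _ _) _; apply: lerD; first exact: A_le.
  exact: (adjoint_deriv_dist_le (@hdiff i)).
have [r0|r_neq0] := eqVneq r 0.
  near=> k; rewrite -/(A _ _) -/(rd k).
  have A0 : A x 0 = 0 by apply/eqP; rewrite -normr_le0 -(normr0 Y); exact: A_le.
  rewrite r0 A0 subr0 normr0 mulr0 addr0 normrZ subr0.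
  have : `|A (xd_ k n) (rd k)| <= `|rd k| by exact: A_le.
  rewrite /relaxation /loping; case: ifP => _; rewrite ?normr1 ?mul1r//.
  by rewrite normr0 mul0r.
have gap_cvg : (`|rd k| - tau * delta k i) @[k --> \oo] --> `|r|.
  rewrite -[X in _ --> X]subr0 -(mulr0 tau).
  apply: cvgB; [exact: cvg_norm|apply: cvgMr; exact: delta_cvg0].
have r_gt0 : 0 < `|r| by rewrite normr_gt0.
near=> k; have active : tau * delta k i < `|rd k|.
  by rewrite -subr_gt0; near: k; exact: (cvgr_gt _ gap_cvg).
rewrite /relaxation /loping -/(rd k) -/i active.
by rewrite scale1r; exact: A_dist.
Unshelve. all: by end_near. Qed.

(** For every fixed [n], the terminal iterate is no farther from [xs] than the
    [n]-th one: by monotonicity if [n] precedes termination, and because the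
    iteration has come to rest otherwise. So the terminal index needs no control
    as the noise decreases. *)
Lemma noisy_terminal_cvg (nstar : nat -> nat) xs :
  B xs -> is_solution D F y xs -> x_ n @[n --> \oo] --> xs ->
  (forall k, is_termination_index N (xd_ k) (nstar k)) ->
  xd_ k (nstar k) @[k --> \oo] --> xs.
Proof.
move=> Bxs sol x_xs term.
have closer n k : `|xd_ k (nstar k) - xs| <= `|xd_ k n - xs|.
  have [nk|kn] := leqP n (nstar k); first exact: (lLK_fejer (noisy_err k)).
  by rewrite (stationary_cycle_forever (term k).1 (ltnW kn)).
apply/cvgrPdistC_lt => e e0.
have [n _ /(_ n (leqnn n)) /= xn] : \forall n \near \oo, `|x_ n - xs| < e / 2.
  by move/cvgrPdistC_lt : x_xs; apply; rewrite divr_gt0.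
have : \forall k \near \oo, `|xd_ k n - x_ n| < e / 2.
  by move/cvgrPdistC_lt : (@noisy_iterate_cvg n); apply; rewrite divr_gt0.
apply: filterS => k xk; apply: le_lt_trans (closer n k) _.
rewrite -(subrK (x_ n) (xd_ k n)) -addrA [e]splitr.
exact: le_lt_trans (ler_normD _ _) (ltrD xk xn).
Qed.

End NoisyData.

End Monotone.

(** ** The degenerate case of a negative cone constant *)

(** For a negative constant the cone condition forces each operator to be
    constant on the ball, with zero derivative at the centre. *)
Lemma lLK_constant yd delta n : eta < 0 -> iter yd delta n = x0.
Proof.
move=> eta_lt0.
have Bx0 : B x0 by rewrite mem_ballE// subrr normr0 ltW.
have df0 i h : deriv_in (D i) (F i) x0 h = 0.
  (* The cone condition only sees points of the ball, so [h] is rescaled. *)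
  pose t := rho / (`|h| + 1).
  have h1 : 0 < `|h| + 1 by rewrite ltr_wpDl.
  have t0 : 0 < t by rewrite divr_gt0.
  have Bz : B (x0 - t *: h).
    rewrite mem_ballE// addrAC subrr sub0r normrN normrZ ger0_norm ?(ltW t0)//.
    by rewrite mulrAC ler_pdivrMr// ler_wpM2l ?(ltW hrho)// lerDl.
  have := hcone i Bx0 Bz.
  rewrite (increment_eq0_of_neg (hcone i) eta_lt0 Bx0 Bz) subrr normr0 mulr0.
  rewrite sub0r normrN opprB addrC subrK normr_le0 /deriv_in linearZ/= scaler_eq0.
  by rewrite gt_eqF//= => /eqP.
elim: n => [//|n IH]; rewrite lLKS IH; set w := relaxation _ _ _; set v := residual _ _ _.
have : `|adjoint (deriv_in (D (cyc hN n)) (F (cyc hN n)) x0) v| <= 0 * `|v|.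
  apply: adjoint_norm_le => // [|h]; first exact: (deriv_in_continuous (@hdiff _)).
  by rewrite -/(deriv_in _ _ _ _) df0 normr0 mul0r.
by rewrite mul0r normr_le0 => /eqP ->; rewrite scaler0 subr0.
Qed.

End Iteration.

(** * The convergence theorem *)

Theorem theorem1 (R : realType) (X Y : hilbertType R)
  (sepX : separable_space X) (sepY : separable_space Y)
  (N : nat) (hN : (0 < N)%N)
  (D : 'I_N -> set X) (F : 'I_N -> X -> Y) (y : 'I_N -> Y)
  (x0 : X) (rho eta tau : R)
  (hrho : 0 < rho)
  (hD : forall i, closed_ball x0 rho `<=` D i)
  (hdiff : forall i x, closed_ball x0 rho x -> differentiable_in (D i) (F i) x)
  (hscale : forall i x, closed_ball x0 rho x ->
     opnorm (deriv_in (D i) (F i) x) <= 1)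
  (htcc : forall i, tangential_cone (D i) (closed_ball x0 rho) (F i) eta)
  (heta : eta < 1 / 2)
  (hsol : exists xs, closed_ball x0 (rho / 2) xs /\ is_solution D F y xs)
  (htau : 2 * ((1 + eta) / (1 - 2 * eta)) < tau) :
  exists xdag : X,
    [/\ unique (is_min_dist_solution D F y x0) xdag,
        (* exact data *)
        (exists xs, is_solution D F y xs /\
           lLK hN D F y (fun=> 0) tau x0 n @[n --> \oo] --> xs) /\
        (kernel_condition D (closed_ball x0 rho) F xdag ->
           lLK hN D F y (fun=> 0) tau x0 n @[n --> \oo] --> xdag),
        (* noisy data: the iteration terminates *)
        (forall (delta : 'I_N -> R) (yd : 'I_N -> Y),
           is_noisy_data y yd delta ->
           exists nstar,
             is_termination_index N (lLK hN D F yd delta tau x0) nstar) &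
        (* noisy data: limit as delta -> 0 *)
        (forall i, continuous_deriv_on (D i) (closed_ball x0 rho) (F i)) ->
          (exists xs, is_solution D F y xs /\
             noisy_limit hN D F y tau x0 xs) /\
          (kernel_condition D (closed_ball x0 rho) F xdag ->
             noisy_limit hN D F y tau x0 xdag)].
Proof.
have [xs0 [xs0_ball xs0_sol]] := hsol.
have [xd [xdP xd_unique]] := min_dist_solution_unique_exists
  hrho hD hdiff hscale htcc heta xs0_ball xs0_sol.
exists xd; have [eta_lt0|eta0] := ltP eta 0.
  have stay yd delta n : lLK hN D F yd delta tau x0 n = x0.
    exact: (lLK_constant hN tau hrho hdiff htcc).
  have x0_sol : is_solution D F y x0.
    have Bx0 : closed_ball x0 rho x0 by rewrite mem_ballE// subrr normr0 ltW.
    move=> i; split; first exact: hD.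
    rewrite -(xs0_sol i).2; apply: (increment_eq0_of_neg (htcc i)) => //.
    exact: solution_in_ball.
  have xd_x0 : xd = x0.
    by apply: xd_unique; split=> // z _; rewrite subrr normr0.
  have noisy_x0 : noisy_limit hN D F y tau x0 x0.
    by move=> delta yd nstar _ _ _; apply: cvg_near_cst; apply: nearW => k; exact: stay.
  have exact_x0 : lLK hN D F y (fun=> 0) tau x0 n @[n --> \oo] --> x0.
    by apply: cvg_near_cst; apply: nearW => n; exact: stay.
  split=> //; rewrite ?xd_x0.
  - by split=> //; exists x0.
  - move=> delta yd _; exists 0%N; split=> [|//].
    by split=> // j _; rewrite !stay.
  - by move=> _; split=> //; exists x0.
have [xs [Bxs xs_sol x_cvg]] := exact_cvg_solution hN
  hrho hD hdiff hscale htcc heta xs0_ball xs0_sol eta0 htau.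
have xs_xd := exact_limit_min_dist
  hrho hdiff hscale htcc heta xs0_ball xs0_sol eta0 htau Bxs xs_sol x_cvg xdP.
split=> //.
- by split; [exists xs|move=> /xs_xd <-].
- move=> delta yd noisy; apply: (lLK_terminates hN
    hrho hdiff hscale htcc heta xs0_ball xs0_sol eta0 htau) => i.
    exact/ltW/(noisy i).2.
  exact: (noisy i).1.
- move=> deriv_cont; have lim_xs : noisy_limit hN D F y tau x0 xs.
    move=> delta yd nstar noisy noise_cvg0 term.
    exact: (noisy_terminal_cvg hrho hdiff hscale htcc heta xs0_ball xs0_sol
      eta0 htau noisy noise_cvg0 deriv_cont Bxs xs_sol x_cvg term).
  by split; [exists xs|move=> /xs_xd <-].
Qed.
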